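(* Let $X$ be a simplicial complex, $m\in\mathbb{N}$, and let $[\alpha] \in \mathrm{Free}\, H^m(X;\mathbb{Z})$ have winding number $w$. Then for any $[\beta] \in H_m(X;\mathbb{Z})$, the winding number $w$ divides the Kronecker pairing $\langle [\alpha],[\beta]\rangle$. Moreover, suppose that $$\langle [\alpha],[\beta]\rangle = \pm\prod_{i\in I} p_i^{n_i}$$ for some (finitely many) primes $p_i$ and integers $n_i\in\mathbb{N}$. For each $i \in I$ consider the map $H^m(X;\mathbb{Z})\to H^m(X;\mathbb{F}_{p_i})$ induced by the quotient map $\mathbb{Z}\to\mathbb{F}_{p_i}$, and let $[\alpha^{p_i}]$ be the image of $[\alpha]$. If $[\alpha^{p_i}] = 0$ in $H^m(X;\mathbb{F}_{p_i})$, then the winding number of $[\alpha]$ is divisible by $p_i$. If $[\alpha]$ does not map to zero for any of the primes $p_i$, $i \in I$, then $[\alpha]$ has winding number $1$ (up to sign).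
   Context: $\mathrm{Free}\,H^m(X;\mathbb{Z})$ denotes the free part of $H^m(X;\mathbb{Z})$, i.e. a fixed free subgroup complementary to the torsion subgroup, having a finite basis (automatic when $X$ is finite). Winding number: a class $[\alpha]\in\mathrm{Free}\,H^m(X;\mathbb{Z})$ has winding number $w \in \mathbb{Z}$ if there is a basis $(g_1,\dots,g_n)$ of $\mathrm{Free}\,H^m(X;\mathbb{Z})$ such that $[\alpha] = w g_i$ for some $i$. The winding number is well defined up to sign. The Kronecker pairing $\langle\cdot,\cdot\rangle : H^m(X;\mathbb{Z})\times H_m(X;\mathbb{Z})\to\mathbb{Z}$ is evaluation of cocycles on cycles. *)

(* Defs.v *)
From HB Require Import structures.
From mathcomp Require Import all_boot all_order all_algebra finmap.
From mathcomp Require Import boolp classical_sets functions.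
From mathcomp.multinomials Require Export freeg.
Set Implicit Arguments.
Unset Strict Implicit.
Unset Printing Implicit Defensive.
Import Order.TTheory GRing.Theory Num.Theory.
Local Open Scope fset_scope.
Local Open Scope quotient_scope.
Local Open Scope ring_scope.

(* The subquotient ker g / (im f `&` ker g) of B. *)
Section Subquotient.
Variables (A B C : zmodType) (f : {additive A -> B}) (g : {additive B -> C}).

Definition ker_pred : {pred B} := [pred x | g x == 0].

Lemma ker_pred_closed : zmod_closed ker_pred.
Proof.
split=> [|x y]; rewrite !inE ?raddf0 // => /eqP gx /eqP gy.
by rewrite raddfB gx gy subr0.
Qed.
HB.instance Definition _ := GRing.isZmodClosed.Build B ker_pred ker_pred_closed.

Definition ker_type := {x : B | x \in ker_pred}.
HB.instance Definition _ := SubChoice.on ker_type.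
HB.instance Definition _ := [SubChoice_isSubZmodule of ker_type by <:].

Definition im_pred : {pred ker_type} :=
  [pred z : ker_type | `[< exists a : A, val z = f a >]].

Lemma im_pred_closed : zmod_closed im_pred.
Proof.
split=> [|x y]; rewrite !inE; first by exists 0; rewrite !raddf0.
by move=> [a xa] [b yb]; exists (a - b); rewrite !raddfB /= xa yb.
Qed.
HB.instance Definition _ :=
  GRing.isZmodClosed.Build ker_type im_pred im_pred_closed.

Definition subquotient := Quotient.quot im_pred.
HB.instance Definition _ := Quotient.on subquotient.
HB.instance Definition _ := GRing.Zmodule.on subquotient.

Definition class_of (z : ker_type) : subquotient := \pi z.

Lemma class_of_eq (x y : ker_type) :
  class_of x = class_of y <-> exists a, val x - val y = f a.
Proof.
split=> [/eqP|]; last move=> H; last apply/eqP.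
  by rewrite -Quotient.idealrBE inE => -[a]; rewrite raddfB; exists a.
by rewrite -Quotient.idealrBE inE raddfB.
Qed.

Lemma class_of_repr (z : ker_type) :
  exists a, val (repr (class_of z)) - val z = f a.
Proof. by apply/class_of_eq; rewrite /class_of reprK. Qed.

End Subquotient.
Arguments class_of {A B C f g}.
Arguments class_of_eq {A B C f g}.
Arguments class_of_repr {A B C} f {g}.

(* Linear extension to {freeg K} of a map from K to an abelian group; zmodule A
   is A with its canonical int-module structure. *)
Section LinearExtension.
Variables (K : choiceType) (A : zmodType).
Implicit Types (f g : K -> A) (c : {freeg K}).

Definition linext f c : A := fglift (f : K -> zmodule A) c.

Lemma linext_is_additive f : additive (linext f).
Proof. exact (@lift_is_additive int K (zmodule A) f). Qed.
HB.instance Definition _ f :=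
  GRing.isAdditive.Build {freeg K} A (linext f) (linext_is_additive f).

Lemma linextU f n k : linext f << n *g k >> = f k *~ n.
Proof. exact (@liftU int (zmodule A) K f n k). Qed.

Lemma linextE f c : linext f c = \sum_(k <- dom c) f k *~ coeff k c.
Proof.
rewrite -[in LHS](freeg_sumE c) raddf_sum.
by apply: eq_bigr => k _; rewrite /= linextU.
Qed.

Lemma linextBl f g c : linext (f - g) c = linext f c - linext g c.
Proof.
rewrite !linextE -sumrB; apply: eq_bigr => k _.
by rewrite -mulrzBl.
Qed.

End LinearExtension.

Lemma linext_comp (K : choiceType) (A B : zmodType) (h : {additive A -> B})
  (f : K -> A) (c : {freeg K}) : linext (h \o f) c = h (linext f c).
Proof.
by rewrite !linextE raddf_sum; apply: eq_bigr => k _; rewrite raddfMz.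
Qed.

Record simplicial_complex (V : choiceType) := SimplicialComplex {
  faces :> set {fset V};
  faces_neq0 : forall s, faces s -> s != fset0;
  faces_sub : forall s t, faces s -> t `<=` s -> t != fset0 -> faces t }.

(* The total order on the vertices only serves to orient the simplices; every
   vertex set can be given one, and different orders give isomorphic groups. *)
Section SimplicialChains.
Context {d : Order.disp_t} {V : orderType d}.
Variable X : simplicial_complex V.

(* Simplices, chains and cochains are graded by the number k of vertices, i.e. by
   dimension plus 1; (co)homology below is graded by the dimension m. As fset0 is not a face, simplex 0 is empty: the groups in dimension -1 vanish
   and vertices have zero boundary. *)
Definition simplex (k : nat) := {s : {fset V} | (s \in faces X) && (#|` s| == k)}.
HB.instance Definition _ k := SubChoice.on (simplex k).

Definition chain (k : nat) := {freeg (simplex k)}.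
HB.instance Definition _ k := GRing.Zmodule.on (chain k).

(* The position of v when the vertices of s are listed in increasing order. *)
Definition vpos (s : {fset V}) (v : V) : nat := #|` [fset u in s | (u < v)%O]|.

(* The sum of (-1)^i [v_0, .., v_i omitted, .., v_k] over the vertices
   v_0 < .. < v_k of s; insub only fails when s `\ v is empty. *)
Definition boundary_simplex (k : nat) (s : simplex k.+1) : chain k :=
  \sum_(v <- val s)
    oapp (fun t => << (-1) ^+ vpos (val s) v *g t >>) 0 (insub (val s `\ v)).

Definition boundary (k : nat) : chain k.+1 -> chain k :=
  linext (@boundary_simplex k).
HB.instance Definition _ k := GRing.Additive.on (@boundary k).

Section Cochains.
Variable A : zmodType.

(* Cochains are maps on simplices, i.e. by linear extension homomorphisms
   from the chains to A. *)
Definition cochain (k : nat) := simplex k -> A.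
HB.instance Definition _ k := GRing.Zmodule.on (cochain k).

Definition eval (k : nat) (phi : cochain k) (c : chain k) : A := linext phi c.

Definition coboundary (k : nat) (phi : cochain k) : cochain k.+1 :=
  fun s => eval phi (boundary << s >>).

Lemma coboundary_is_additive k : additive (@coboundary k).
Proof. by move=> f g; apply/funext => s; apply: linextBl. Qed.
HB.instance Definition _ k :=
  GRing.isAdditive.Build (cochain k) (cochain k.+1) (@coboundary k)
    (@coboundary_is_additive k).

Lemma eval_coboundary k (phi : cochain k) c :
  eval (coboundary phi) c = eval phi (boundary c).
Proof.
rewrite /eval [LHS]linextE /boundary [in RHS](linextE (@boundary_simplex k)).
rewrite raddf_sum; apply: eq_bigr => s _ /=.
by rewrite raddfMz /coboundary /eval /boundary linextU mulr1z.
Qed.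

End Cochains.


Lemma vposD1 (s : {fset V}) v w : v \in s -> w \in s -> (v < w)%O ->
  vpos (s `\ w) v = vpos s v /\ vpos s w = (vpos (s `\ v) w).+1.
Proof.
move=> vs ws vw; split.
  congr #|` _|; apply/fsetP => u; rewrite !inE.
  by case: eqVneq => //= ->; rewrite [(w < v)%O]lt_gtF // andbF.
rewrite {1}/vpos (cardfsD1 v) !inE vs vw add1n; congr S.
by congr #|` _|; apply/fsetP => u; rewrite !inE andbA.
Qed.

Lemma boundaryK (k : nat) (c : chain k.+2) : boundary (boundary c) = 0.
Proof.
suff bs0 (s : simplex k.+2) : boundary (boundary_simplex s) = 0.
  rewrite [X in boundary X]linextE raddf_sum big1 // => s _ /=.
  by rewrite raddfMz /= bs0 mul0rz.
have [S SE] : {S | S = val s} by exists (val s).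
have /andP[] := valP s; rewrite -SE => SX /eqP cS.
pose U (t : {fset V}) : chain k :=
  oapp (fun t' : simplex k => << t' >>) 0 (insub t).
pose T v w := U (S `\ v `\ w) *~ ((-1) ^+ vpos S v * (-1) ^+ vpos (S `\ v) w).
have TN v w : v \in S -> w \in S -> (v < w)%O -> T w v = - T v w.
  move=> vS wS vw; rewrite /T; have [-> ->] := vposD1 vS wS vw.
  have -> : S `\ w `\ v = S `\ v `\ w.
    by apply/fsetP => u; rewrite !inE andbCA.
  by rewrite exprS mulN1r mulNr mulrNz mulrC.
have -> : boundary (boundary_simplex s) =
    \sum_(v <- S) \sum_(w <- S | w != v) T v w.
  rewrite /boundary_simplex raddf_sum /= -SE.
  rewrite big_seq [RHS]big_seq; apply: eq_bigr => v vS.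
  have Sv : (S `\ v \in faces X) && (#|` S `\ v| == k.+1).
    have sv1 : #|` S `\ v| = k.+1.
      by apply/eqP; rewrite -eqSS -cS [in X in _ == X](cardfsD1 v) vS.
    rewrite sv1 eqxx andbT inE; apply: (@faces_sub _ X S).
    - by move: SX; rewrite inE.
    - exact: fsubsetDl.
    - by rewrite -cardfs_gt0 sv1.
  rewrite insubT /= /boundary linextU /boundary_simplex mulrz_suml SubK.
  rewrite -[RHS]big_filter [RHS](perm_big (enum_fset (S `\ v))) /=; last first.
    apply: uniq_perm; rewrite ?filter_uniq ?fset_uniq // => w.
    by rewrite mem_filter !inE.
  apply: eq_bigr => w _; rewrite /T /U.
  case: insubP => [t _ _|_] /=; last by rewrite !mul0rz.
  rewrite !freegU_mulz freeg_mulz; congr << _ *g _ >>.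
  by rewrite mulrzz mulrC intz.
pose T1 := \sum_(v <- S) \sum_(w <- S | (v < w)%O) T v w.
have -> : \sum_(v <- S) \sum_(w <- S | w != v) T v w =
    T1 + \sum_(v <- S) \sum_(w <- S | (w < v)%O) T v w.
  rewrite -big_split; apply: eq_bigr => v _ /=.
  rewrite (bigID (fun w => (v < w)%O)) /=; congr (_ + _); apply: eq_bigl => w.
    by case: ltgtP.
  by case: ltgtP.
rewrite [X in _ + X](exchange_big_dep xpredT) //= -big_split big_seq big1 //.
move=> v vS /=; rewrite -big_split big_seq_cond big1 // => w /andP[wS vw] /=.
by rewrite (TN v w) // subrr.
Qed.

Lemma coboundaryK (A : zmodType) (k : nat) (phi : cochain A k) :
  coboundary (coboundary phi) = 0.
Proof.
by apply/funext => s; rewrite {1}/coboundary eval_coboundary boundaryK /eval raddf0.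
Qed.

Definition homology (m : nat) := subquotient (@boundary m.+1) (@boundary m).
HB.instance Definition _ m := GRing.Zmodule.on (homology m).

Definition cohomology (A : zmodType) (m : nat) :=
  subquotient (@coboundary A m) (@coboundary A m.+1).
HB.instance Definition _ A m := GRing.Zmodule.on (cohomology A m).

Definition cocycle (A : zmodType) (m : nat) := ker_type (@coboundary A m.+1).
Definition cycle (m : nat) := ker_type (@boundary m).

Section ChangeOfCoefficients.
Variables (A B : zmodType) (h : {additive A -> B}) (m : nat).

Lemma coboundary_comp k (phi : cochain A k) :
  coboundary (h \o phi : cochain B k) = h \o coboundary phi.
Proof. by apply/funext => s; apply: linext_comp. Qed.

Lemma change_coeffs_subproof (z : cocycle A m) :
  (h \o val z : cochain B m.+1) \in ker_pred (@coboundary B m.+1).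
Proof.
have /eqP zK := valP z; rewrite unfold_in /= coboundary_comp zK.
rewrite (_ : h \o _ = 0); first exact: eqxx. exact (funext (fun _ => raddf0 h)).
Qed.

Definition cocycle_change_coeffs (z : cocycle A m) : cocycle B m :=
  Sub (h \o val z : cochain B m.+1) (change_coeffs_subproof z).

Definition change_coeffs (a : cohomology A m) : cohomology B m :=
  class_of (cocycle_change_coeffs (repr a)).

Lemma change_coeffsE (z : cocycle A m) :
  change_coeffs (class_of z) = class_of (cocycle_change_coeffs z).
Proof.
have [psi e] := class_of_repr (@coboundary A m) z.
apply: (class_of_eq (cocycle_change_coeffs _) (cocycle_change_coeffs z)).2.
exists (h \o psi : cochain B m).
rewrite /= coboundary_comp -e; apply/esym.
exact (funext (fun _ => raddfB h _ _)).
Qed.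

End ChangeOfCoefficients.

(* For p prime, intr is the quotient map from int to 'F_p. *)
Definition reduction (p m : nat) : cohomology int m -> cohomology 'F_p m :=
  @change_coeffs _ _ (intr : {additive int -> 'F_p}) m.

Definition kronecker (m : nat) (a : cohomology int m) (b : homology m) : int :=
  eval (val (repr a)) (val (repr b)).

Lemma kroneckerE (m : nat) (phi : cocycle int m) (c : cycle m) :
  kronecker (class_of phi) (class_of c) = eval (val phi) (val c).
Proof.
have [psi /= ephi] := class_of_repr (@coboundary int m) phi.
have [e /= ec] := class_of_repr (@boundary m.+1) c.
have /eqP phiK : coboundary (val phi) == 0 := valP phi.
have cK : boundary (val (repr (class_of c : homology m))) = 0.
  by apply/eqP; exact: (valP (repr (class_of c : homology m))).
transitivity (eval (val phi) (val (repr (class_of c : homology m)))).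
  apply/eqP; rewrite -subr_eq0 -linextBl ephi.
  by rewrite -/(eval _ _) eval_coboundary cK /eval raddf0.
apply/eqP; rewrite -subr_eq0 -raddfB ec.
rewrite -[X in X == 0]/(eval (val phi) (boundary e)) -eval_coboundary phiK /eval linextE big1 // => s _.
by rewrite mul0rz.
Qed.

End SimplicialChains.

Section WindingNumber.
Local Open Scope classical_set_scope.
Variable M : zmodType.
Implicit Types (F : set M) (a : M) (w : int).

Definition torsion : set M := [set x | exists2 n : nat, (0 < n)%N & x *+ n = 0].

Definition is_basis F (n : nat) (g : 'I_n -> M) : Prop :=
  [/\ forall i, F (g i),
      forall x, F x -> exists c : 'I_n -> int, x = \sum_i g i *~ c i &
      forall c : 'I_n -> int, \sum_i g i *~ c i = 0 -> forall i, c i = 0].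

Definition free_part F : Prop :=
  [/\ F 0 /\ (forall x y, F x -> F y -> F (x - y)),
      F `&` torsion = [set 0],
      (forall x, exists y z, [/\ F y, torsion z & x = y + z]) &
      exists n (g : 'I_n -> M), is_basis F g].

Definition winding_number F a w : Prop :=
  exists n (g : 'I_n -> M) (i : 'I_n), is_basis F g /\ a = g i *~ w.

End WindingNumber.

(* Main.v *)
(** The reduction of [a] modulo [p] vanishes iff [a] is a multiple of [p]: a
primitive of the reduced cocycle lifts to an integral cochain, and once its
coboundary is subtracted the cocycle becomes [p] times a cochain, which is
closed because [int] is torsion-free.  Since the torsion-free subgroup
[F] is complementary to the torsion, [p * b] in [F] equals [p] times the
component of [b] in [F]; hence [p] divides the only nonzero coordinate [w] of
[alpha] in the basis.  Conversely, if [w] is not a unit, then a prime factor of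
[w] divides the Kronecker pairing, so it is one of the [p_i], and [alpha]
vanishes modulo this [p_i]. *)

Require Import Defs.
From HB Require Import structures.
From mathcomp Require Import all_boot all_order all_algebra.
From mathcomp Require Import boolp classical_sets.
From mathcomp Require Import zify.
Import GRing.Theory Num.Theory.
Local Open Scope ring_scope.

Section SubquotientClasses.
Context {A B C : zmodType} {f : {additive A -> B}} {g : {additive B -> C}}.

Lemma class_ofK (a : subquotient f g) : class_of (repr a) = a.
Proof. exact: reprK. Qed.

Lemma class_of_is_zmod_morphism : zmod_morphism (@class_of A B C f g).
Proof. by move=> x y; rewrite /class_of raddfB. Qed.

HB.instance Definition _ :=
  GRing.isZmodMorphism.Build (ker_type g) (subquotient f g) class_of
    class_of_is_zmod_morphism.

End SubquotientClasses.

Section Cohomology.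
Context {d : Order.disp_t} {V : orderType d} (X : simplicial_complex V).
Variable m : nat.

(** The homology class comes first so that, with [b] fixed, the pairing is a map of the cohomology
    class alone and can be declared additive. *)
Definition kroneckerl (b : homology X m) (a : cohomology X int m) : int :=
  kronecker a b.

Lemma kroneckerl_is_zmod_morphism b : zmod_morphism (kroneckerl b).
Proof.
move=> a a'; rewrite -[a]class_ofK -[a']class_ofK -[b]class_ofK -raddfB.
by rewrite /kroneckerl !kroneckerE; exact: linextBl.
Qed.

HB.instance Definition _ b :=
  GRing.isZmodMorphism.Build (cohomology X int m) int
    (kroneckerl b) (kroneckerl_is_zmod_morphism b).

Lemma kroneckerMz a b n : @kronecker d V X m (a *~ n) b = kronecker a b * n.
Proof. by rewrite -[kronecker _ b]/(kroneckerl b _) raddfMz /= mulrzz. Qed.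

Lemma change_coeffs_is_zmod_morphism (A B : zmodType) (h : {additive A -> B}) :
  zmod_morphism (@change_coeffs d V X A B h m).
Proof.
move=> a a'; rewrite -[a]class_ofK -[a']class_ofK -raddfB !change_coeffsE.
rewrite -raddfB; congr class_of; apply: val_inj; apply/funext => s.
exact: raddfB.
Qed.

HB.instance Definition _ (A B : zmodType) (h : {additive A -> B}) :=
  GRing.isZmodMorphism.Build (cohomology X A m) (cohomology X B m)
    (@change_coeffs d V X A B h m) (change_coeffs_is_zmod_morphism A B h).

Lemma cochain_mulrnE (A : zmodType) k (phi : cochain X A k) n s :
  (phi *+ n) s = phi s *+ n.
Proof. by elim: n => [|n IH]; rewrite ?mulr0n // !mulrS -IH. Qed.

Lemma reduction_eq0 p (a : cohomology X int m) : prime p ->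
  reduction p a = 0 <-> exists b, a = b *+ p.
Proof.
move=> p_pr; split=> [|[b ->]]; last first.
  rewrite /reduction raddfMn /= -[change_coeffs _ _]class_ofK -raddfMn.
  (* The values of [z] lie in ['F_p], so [p] kills it already as a cocycle. *)
  set z := repr _; suff -> : z *+ p = 0 by rewrite raddf0.
  apply: val_inj; rewrite raddfMn; apply/funext => s.
  by rewrite cochain_mulrnE -mulr_natr pchar_Fp_0 // mulr0.
rewrite -[a]class_ofK /reduction change_coeffsE -(raddf0 class_of).
move: (repr a) => phi /class_of_eq[psi].
rewrite subr0 => phiE.
(* [psi] is a primitive of the reduced cocycle; [lift] takes the representative of each value in the
   range from 0 to [p - 1]. *)
pose lift : cochain X int m := fun s => (psi s : nat)%:Z.
have psiE : psi = intr \o lift.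
  by apply/funext => s; rewrite /lift /= -pmulrn natr_Zp.
pose delta : cochain X int m.+1 := val phi - coboundary lift.
(* The division is exact: [val phi] and [coboundary lift] both reduce to [coboundary psi] modulo
   [p]. *)
pose theta : cochain X int m.+1 := fun s => (delta s %/ p)%Z.
have deltaE : delta = theta *+ p.
  apply/funext => s; rewrite cochain_mulrnE -mulr_natr natz divzK //.
  rewrite (dvdz_pcharf (pchar_Fp p_pr)) rmorphB subr_eq0.
  move/(congr1 (@^~ s)): phiE => /= ->; apply/eqP.
  rewrite psiE.
  have := coboundary_comp (intr : {additive int -> 'F_p}) lift.
  exact: (congr1 (@^~ s)).
have delta_closed : coboundary delta = 0.
  rewrite /delta raddfB /=.
  by rewrite coboundaryK subr0; apply/eqP/(valP phi).
have theta_closed : theta \in ker_pred (@coboundary d V X int m.+1).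
  apply/eqP; apply/funext => s; apply/eqP.
  have /(congr1 (@^~ s)) := delta_closed.
  rewrite deltaE raddfMn cochain_mulrnE => /eqP.
  by rewrite mulrn_eq0 eqn0Ngt prime_gt0.
exists (class_of (exist _ theta theta_closed)).
rewrite -raddfMn; apply/class_of_eq; exists lift.
by rewrite raddfMn /= -deltaE /delta opprB addrC subrK.
Qed.

End Cohomology.

Section WindingNumber.
Context {M : zmodType} (F : set M) (F_free : free_part F).

Lemma free_part_mulrn a b n : (0 < n)%N -> F a -> a = b *+ n ->
  exists2 y, F y & a = y *+ n.
Proof.
case: F_free => -[F0 FB] Ftors /(_ b)[y [t [Fy [k k0 tk] bE]]] _ n0 Fa aE.
have FN x : F x -> F (- x) by move=> Fx; rewrite -sub0r; apply: FB.
have FMn x j : F x -> F (x *+ j).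
  move=> Fx; elim: j => [|j IH]; rewrite ?mulr0n // mulrSr -[x in _ + x]opprK.
  exact: FB IH (FN _ Fx).
(* The difference [a - y *+ n] lies in [F] and equals [t *+ n], which is torsion because [t] is. *)
exists y => //; apply/eqP; rewrite -subr_eq0; apply/eqP.
suff : (F `&` @torsion M)%classic (a - y *+ n) by rewrite Ftors.
split; first exact: FB Fa (FMn _ _ Fy).
by exists k => //; rewrite aE bE -mulrnBl addrC addKr mulrnAC tk mul0rn.
Qed.

Lemma winding_number_dvd a w b n : (0 < n)%N -> F a ->
  winding_number F a w -> a = b *+ n -> (n %| w)%Z.
Proof.
move=> n0 Fa [k [g [i [[_ gspan gfree] aw]]]] /(free_part_mulrn _ _ _ n0 Fa).
case=> y /gspan[c ->] ac.
(* Two expansions of [a] in the basis [g] are subtracted: [n] times that of [y], and [g i *~ w]. The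
   coordinate at [i] gives [w = c i * n]. *)
have /gfree/(_ i) :
    \sum_j g j *~ (c j * n - (if j == i then w else 0)) = 0.
  under eq_bigr => j _ do rewrite mulrzBr mulrzA.
  rewrite sumrB -mulrz_suml -pmulrn -ac aw (bigD1 i) //= eqxx.
  by rewrite big1 ?addr0 ?subrr // => j /negPf ->; rewrite mulr0z.
by rewrite eqxx => /eqP; rewrite subr_eq0 => /eqP <-; apply: dvdz_mull.
Qed.

End WindingNumber.

Theorem proposition4p2 (d : Order.disp_t) (V : orderType d)
  (X : simplicial_complex V) (m : nat)
  (F : set (cohomology X int m)) (F_free : free_part F)
  (alpha : cohomology X int m) (alpha_F : F alpha)
  (w : int) (alpha_w : winding_number F alpha w) :
  (forall beta : homology X m, (w %| kronecker alpha beta)%Z) /\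
  (forall (beta : homology X m) (I : finType) (p n : I -> nat),
     (forall i, prime (p i)) ->
     (kronecker alpha beta = (\prod_i p i ^ n i)%N%:Z \/
      kronecker alpha beta = - (\prod_i p i ^ n i)%N%:Z) ->
     (forall i, reduction (p i) alpha = 0 -> ((p i)%:Z %| w)%Z) /\
     ((forall i, reduction (p i) alpha <> 0) -> w = 1 \/ w = -1)).
Proof.
have [k [g [i [_ alphaE]]]] := alpha_w.
have w_dvd beta : (w %| kronecker alpha beta)%Z.
  by rewrite alphaE kroneckerMz dvdz_mull.
split=> // beta I p n p_pr K_eq; split=> [j|red_neq0].
  move=> /(reduction_eq0 _ _ _ _ (p_pr j))[b].
  exact: winding_number_dvd (prime_gt0 (p_pr j)) alpha_F alpha_w.
have w_dvd_prod : (`|w| %| \prod_i p i ^ n i)%N.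
  by have := w_dvd beta; rewrite dvdzE; case: K_eq => ->; rewrite ?abszN.
suff : `|w|%N = 1%N by lia.
apply/eqP; apply: contraT => w_neq1.
(* A divisor of a positive product is nonzero; together with [w_neq1] this provides a prime factor
   of [w]. *)
have w_gt0 : (0 < `|w|)%N.
  apply: dvdn_gt0 w_dvd_prod; rewrite prodn_gt0 // => j.
  by rewrite expn_gt0 prime_gt0.
have q_pr : prime (pdiv `|w|) by apply: pdiv_prime; lia.
have := dvdn_trans (pdiv_dvd _) w_dvd_prod.
rewrite Euclid_dvd_prod // big_has => /hasP[j _].
(* A prime dividing a power of the prime [p j] is [p j] itself. *)
rewrite Euclid_dvdX // dvdn_prime2 // => /andP[/eqP q_eq _].
case: (red_neq0 j); apply/(reduction_eq0 _ _ _ _ (p_pr j)).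
have /dvdzP[c wE] : ((p j)%:Z %| w)%Z by rewrite dvdzE -q_eq pdiv_dvd.
by exists (g i *~ c); rewrite alphaE wE mulrzA pmulrn.
Qed.
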